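(* Let $0<a<1$ and let $b$ be an integer with $ab\ge 1$. Let $I=[-1,1]$ and let $W:I\times I\to\mathbb{R}$ be the kernel $W(x,y)=\sum_{n=0}^{\infty}a^n\cos(b^n\pi(x-y))$. Let $\mathcal{H}_W$ be the reproducing kernel Hilbert space on $I$ with reproducing kernel $W$, and let $I_W:\mathcal{H}_W\to C(I)$ be the embedding. Then the covering numbers of $I_W$ satisfy $$\ln(\mathcal{C}(\epsilon,I_W))\asymp \frac{\left[\ln\left(\frac{1}{\epsilon(1-a)^{1/2}}\right)\right]^2}{\ln(1/a)}\quad\text{as }\epsilon\to0^+.$$
   Context: $C(I)$ is the real Banach space of continuous real-valued functions on $I$ with the supremum norm. The kernel $W$ is continuous, symmetric and positive definite (i.e. $\sum_{i,j}c_ic_jW(x_i,x_j)\ge0$ for all finite families of points $x_i$ and reals $c_i$), so there is a unique Hilbert space $\mathcal{H}_W$ of real-valued functions on $I$ such that $W(x,\cdot)\in\mathcal{H}_W$ and $f(x)=\langle f,W(x,\cdot)\rangle_W$ for all $x\in I$, $f\in\mathcal{H}_W$; its elements are continuous, and $I_W f=f$. For an operator $T:X\to Y$ between Banach spaces with unit balls $B_X,B_Y$ and $\epsilon>0$, the covering number is $$\mathcal{C}(\epsilon,T)=\min\Big\{n\in\mathbb{N}:\exists\, y_1,\dots,y_n\in Y\ \text{such that}\ T(B_X)\subset\bigcup_{j=1}^n(y_j+\epsilon B_Y)\Big\}.$$ For functions $f,g:(0,\infty)\to\mathbb{R}$, $f(\epsilon)\asymp g(\epsilon)$ as $\epsilon\to0^+$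 means $0<\liminf_{\epsilon\to0^+}\frac{f(\epsilon)}{g(\epsilon)}\le\limsup_{\epsilon\to0^+}\frac{f(\epsilon)}{g(\epsilon)}<\infty$. *)

(* Defs.v *)
From HB Require Import structures.
From mathcomp Require Import all_boot all_order all_algebra.
From mathcomp Require Import all_classical all_reals all_analysis.
From mathcomp Require Import ring lra.

Set Implicit Arguments.
Unset Strict Implicit.
Unset Printing Implicit Defensive.

Import Order.TTheory GRing.Theory Num.Theory.
Import numFieldNormedType.Exports.

Local Open Scope classical_set_scope.
Local Open Scope ring_scope.

Definition itv11 (R : realType) : set R := [set` `[(-1 : R), 1]].
Arguments itv11 : clear implicits.

Notation "''I[' R ]" := (set_type (itv11 R)) (format "''I[' R ]").

Section ContinuousFunctions.
Context {R : realType}.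

Definition ctsI : {pred ('I[R] -> R)} := [pred f | `[< continuous f >]].

Lemma ctsI_submod_closed : submod_closed ctsI.
Proof.
split=> [|c f g /asboolP cf /asboolP cg]; apply/asboolP => x.
  exact: cst_continuous.
apply: (@continuousD R R^o 'I[R] (c *: f) g x) (cg x).
by apply: (@continuousZl_tmp R R^o) (cf x).
Qed.

HB.instance Definition _ :=
  GRing.isSubmodClosed.Build R ('I[R] -> R) ctsI ctsI_submod_closed.

End ContinuousFunctions.

(* The Banach space C(I) of continuous functions on I = [-1, 1]. *)
Record CI (R : realType) := MkCI {
  CI_fun :> 'I[R] -> R ;
  _ : CI_fun \in ctsI }.

HB.instance Definition _ (R : realType) := [isSub for @CI_fun R].
HB.instance Definition _ (R : realType) := [Choice of CI R by <:].
HB.instance Definition _ (R : realType) :=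
  [SubChoice_isSubLmodule of CI R by <:].

Section CI_Banach.
Context {R : realType}.
Implicit Types f g : CI R.

Lemma CI_continuous f : continuous f.
Proof. exact/asboolP/(valP f). Qed.

Lemma CI_bounded f : exists M : R, forall x, `|f x| <= M.
Proof.
pose g : 'I[R] -> R := fun x => `|f x|.
have cg : continuous g.
  move=> x; apply: (@continuous_comp _ _ _ f (fun z : R => `|z|)).
    exact: (@CI_continuous f).
  exact: (@norm_continuous _ R^o).
have /subspace_valL_continuousP' -/(_ 0) ch := cg.
have hE x : valL_ 0 g (\val x) = g x.
  exact: (congr1 (fun h => h x) (valLK 0 g)).
have [|c _ hc] := @EVT_max R (valL_ 0 g) (-1) 1 _ ch; first by lra.
exists (valL_ 0 g c) => x; rewrite -[`|f x|]/(g x) -hE; apply: hc.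
exact: (@set_valP _ (itv11 R) x).
Qed.

Definition CI_norm f : R := sup [set `|f x| | x in [set: 'I[R]]].

Lemma CI_norm_ge f x : `|f x| <= CI_norm f.
Proof.
have [M fM] := CI_bounded f.
by apply: ub_le_sup; [exists M => _ [y _ <-]|exists x].
Qed.

Definition zeroI : 'I[R].
Proof.
by exists 0; apply/mem_set; rewrite /itv11 /= in_itv /= lerN10 ler01.
Defined.

Lemma CI_norm_le f (M : R) : (forall x, `|f x| <= M) -> CI_norm f <= M.
Proof.
move=> fM; apply: ge_sup; last by move=> _ [y _ <-].
by exists `|f zeroI|, zeroI.
Qed.

Lemma CI_normD f g : CI_norm (f + g) <= CI_norm f + CI_norm g.
Proof.
apply: CI_norm_le => x; rewrite (le_trans (ler_normD _ _))//.
by rewrite lerD// CI_norm_ge.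
Qed.

Lemma CI_normZ (c : R) f : CI_norm (c *: f) = `|c| * CI_norm f.
Proof.
apply/eqP; rewrite eq_le; apply/andP; split.
  by apply: CI_norm_le => x; rewrite normrM ler_wpM2l// CI_norm_ge.
have [->|c0] := eqVneq c 0.
  by rewrite normr0 mul0r (le_trans _ (CI_norm_ge _ zeroI)).
rewrite mulrC -ler_pdivlMr ?normr_gt0//; apply: CI_norm_le => x.
rewrite ler_pdivlMr ?normr_gt0// mulrC -normrM.
exact: (CI_norm_ge (c *: f)).
Qed.

Lemma CI_norm0_eq0 f : CI_norm f = 0 -> f = 0.
Proof.
move=> f0; apply/val_inj/funext => x /=; apply/eqP.
by rewrite -normr_le0 -f0 CI_norm_ge.
Qed.

HB.instance Definition _ :=
  Lmodule_isNormed.Build R (CI R) CI_normD CI_normZ CI_norm0_eq0.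

Lemma CI_normE f : `|f| = sup [set `|f x| | x in [set: 'I[R]]].
Proof. by []. Qed.

Lemma CI_complete (F : set_system (CI R)) :
  ProperFilter F -> cauchy F -> cvg F.
Proof.
move=> FF Fc.
have Fnear (e : R) : 0 < e -> exists f0, \forall f \near F, `|f0 - f| < e.
  by move=> e0; have /cauchyP Fe := Fc; have [f0] := Fe e e0; exists f0.
have le_pt f g x : `|f x - g x| <= `|f - g| := CI_norm_ge (f - g) x.
pose l x := lim ((fun f : CI R => (f x : R)) @ F).
have cvgl x : (fun f : CI R => (f x : R)) @ F --> l x.
  apply/cauchy_cvgP/cauchy_exP => e e0; have [f0 Ff0] := Fnear _ e0.
  exists (f0 x); apply: filterS Ff0 => f; rewrite /ball/=.
  exact/le_lt_trans/le_pt.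
have Fl (e : R) : 0 < e -> exists f0, (\forall f \near F, `|f0 - f| < e) /\
    forall x, `|f0 x - l x| <= e.
  move=> e0; have [f0 Ff0] := Fnear _ e0; exists f0; split => // x.
  have : `|f0 x - g x| @[g --> F] --> `|f0 x - l x|.
    apply: cvg_norm; apply: (@cvgB _ R^o _ _ _ (fun=> f0 x) _ (f0 x)).
      exact: cvg_cst.
    exact: cvgl.
  move=> /cvgr_to_le; apply; apply: filterS Ff0 => f /ltW.
  exact/le_trans/le_pt.
have cl : continuous l.
  move=> x; have dist := @cvgrPdist_lt R R^o 'I[R] (nbhs x) (nbhs_filter x).
  apply/dist => e e0.
  have [f0 [_ f0l]] := Fl (e / 3) ltac:(by rewrite divr_gt0).
  have /dist/(_ (e / 3) ltac:(by rewrite divr_gt0)) := @CI_continuous f0 x.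
  apply: filterS => y f0xy.
  have -> : l x - l y = - (f0 x - l x) + (f0 x - f0 y) + (f0 y - l y) by ring.
  rewrite (le_lt_trans (ler_normD _ _))//.
  rewrite (le_lt_trans (lerD (ler_normD _ _) (lexx _)))//.
  by rewrite normrN; have := f0l x; have := f0l y; lra.
apply/cvg_ex; exists (MkCI (asboolT cl)); apply/cvgrPdist_lt => e e0.
have [f0 [Ff0 f0l]] := Fl (e / 2) ltac:(by rewrite divr_gt0).
apply: filterS Ff0 => f f0f; rewrite [e]splitr -(subrKA f0).
rewrite (le_lt_trans (ler_normD _ _))// ler_ltD//.
by apply: CI_norm_le => x /=; rewrite distrC.
Qed.

HB.instance Definition _ := Uniform_isComplete.Build (CI R) CI_complete.

End CI_Banach.

Section Covering.
Context {R : realType}.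

Definition unit_ball (X : completeNormedModType R) : set X :=
  [set x | `|x| <= 1].
Arguments unit_ball : clear implicits.

Definition covered_by (X Y : completeNormedModType R) (eps : R)
    (T : {linear X -> Y}) : set nat :=
  [set n | exists y : 'I_n -> Y,
    T @` unit_ball X `<=`
      \bigcup_j [set y j + eps *: u | u in unit_ball Y]].

(* When no finite cover exists, the value is the junk number 0, which is never
   a genuine covering number since T 0 has to be covered. *)
Definition covering_number (X Y : completeNormedModType R) (eps : R)
    (T : {linear X -> Y}) : nat :=
  xget 0%N [set n | covered_by eps T n /\
                    forall m, covered_by eps T m -> (n <= m)%N].

Definition asymp_at_0 (f g : R -> R) : Prop :=
  let q (e : R) : \bar R := (f e / g e)%:E in
  [/\ 0 < limf_einf q 0^'+, limf_einf q 0^'+ <= limf_esup q 0^'+ &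
      limf_esup q 0^'+ < +oo]%E.

End Covering.

(* A reproducing kernel Hilbert space of functions on X: elements are
   identified with functions through the injective linear map rkhs_fun. *)
Record rkhs (R : realType) (X : Type) (K : X -> X -> R) := RKHS {
  rkhs_space :> completeNormedModType R ;
  rkhs_dot : {dot rkhs_space for idfun} ;
  rkhs_fun : {linear rkhs_space -> (X -> R)} ;
  rkhs_normE : forall f, `|f| = Num.sqrt (rkhs_dot f f) ;
  rkhs_fun_inj : injective rkhs_fun ;
  rkhs_kernel : forall x, exists2 k, rkhs_fun k = K x &
    forall f, rkhs_fun f x = rkhs_dot f k }.

Section RkhsContinuity.
Context {R : realType} {X : topologicalType} {K : X -> X -> R} (H : rkhs K).
Local Notation "''[' u , v ]" := (rkhs_dot H u v).

Lemma rkhs_dotC u v : '[u, v] = '[v, u].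
Proof. by rewrite (@hermC R false idfun H) /= expr0 mul1r. Qed.

Lemma rkhs_dot_ge0 u : 0 <= '[u, u].
Proof.
have [->|u0] := eqVneq u 0; first by rewrite linear0r.
exact/ltW/neq0_dnorm_gt0.
Qed.

Lemma rkhs_dot_lin c u v w : '[c *: u + v, w] = c * '[u, w] + '[v, w].
Proof. by rewrite rkhs_dotC linearP /= ![_ w _]rkhs_dotC. Qed.

Lemma rkhs_CauchySchwarz u v : '[u, v] ^+ 2 <= '[u, u] * '[v, v].
Proof.
have [->|v0] := eqVneq v 0; first by rewrite !linear0r expr0n/= ?mulr0.
have vv : 0 < '[v, v] by exact: neq0_dnorm_gt0.
have := rkhs_dot_ge0 ((- '[u, v] / '[v, v]) *: v + u).
rewrite rkhs_dot_lin !(rkhs_dotC _ (_ + _)) !rkhs_dot_lin (rkhs_dotC v u).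
set p := '[u, v]; set q := '[v, v]; set r := '[u, u].
have -> : - p / q * (- p / q * q + p) + (- p / q * p + r) =
    (r * q - p ^+ 2) / q.
  by field; rewrite gt_eqF.
by rewrite pmulr_lge0 ?invr_gt0// subr_ge0.
Qed.

Lemma rkhs_continuous (cK : continuous (fun p : X * X => K p.1 p.2)) (f : H) :
  continuous (rkhs_fun H f : X -> R).
Proof.
move=> x; apply/(@cvgrPdist_lt R R^o X (nbhs x) (nbhs_filter x)) => e e0.
pose d y := K x x - K x y - K y x + K y y.
have d0 : d y @[y --> x] --> (0 : R^o).
  have -> : 0 = d x by rewrite /d subrr sub0r addNr.
  have cK2 (g h : X -> X) : g y @[y --> x] --> g x -> h y @[y --> x] --> h x ->
      K (g y) (h y) @[y --> x] --> (K (g x) (h x) : R^o).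
    move=> cg ch.
    have cgh : (g y, h y) @[y --> x] --> (g x, h x) by exact: cvg_pair cg ch.
    exact: (cvg_comp _ _ cgh (cK (g x, h x))).
  apply: cvgD; last by apply: (cK2 id id).
  apply: cvgB; last by apply: (cK2 id (fun=> x)) => //; exact: cvg_cst.
  apply: cvgB; first exact: cvg_cst.
  by apply: (cK2 (fun=> x) id) => //; exact: cvg_cst.
pose M := '[f, f] + 1.
have M0 : 0 < M by rewrite ltr_pwDr ?rkhs_dot_ge0.
have /(@cvgrPdist_lt R R^o X (nbhs x) (nbhs_filter x)) := d0.
move=> /(_ _ (divr_gt0 (exprn_gt0 2 e0) M0)).
apply: filterS => y; rewrite sub0r normrN => dy.
have [kx Kx fx] := rkhs_kernel H x; have [ky Ky fy] := rkhs_kernel H y.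
have dE : d y = '[kx - ky, kx - ky].
  rewrite /d -Kx -Ky !fx !fy.
  rewrite linearBr /= !(rkhs_dotC (kx - ky)) !linearBr /=.
  by rewrite (rkhs_dotC ky kx); ring.
rewrite -ltr_sqr ?nnegrE ?(ltW e0)// -normrX ger0_norm ?sqr_ge0//.
have -> : rkhs_fun H f x - rkhs_fun H f y = '[f, kx - ky].
  by rewrite linearBr /= fx fy.
rewrite (le_lt_trans (rkhs_CauchySchwarz _ _))// -dE.
have dy0 : 0 <= d y by rewrite dE rkhs_dot_ge0.
rewrite ger0_norm// ltr_pdivlMr// in dy.
rewrite (le_lt_trans _ dy)// mulrC ler_wpM2l// /M.
by rewrite lerDl ler01.
Qed.

End RkhsContinuity.

Definition weierstrass (R : realType) (a : R) (b : int) (x y : 'I[R]) : R :=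
  limn (series (fun n =>
    a ^+ n * cos ((b ^+ n)%:~R * pi * (\val x - \val y)))).

Lemma weierstrass_continuous (R : realType) (a : R) (b : int) :
  0 < a < 1 -> continuous (fun p : 'I[R] * 'I[R] => weierstrass a b p.1 p.2).
Proof.
move=> /andP[a0 a1].
pose u (t : R) (n : nat) : R := a ^+ n * cos ((b ^+ n)%:~R * pi * t).
pose w t := limn (series (u t)).
have na1 : `|a| < 1 by rewrite ger0_norm// ltW.
have u_le t n : `|u t n| <= geometric 1 a n.
  rewrite /u normrM normrX (ger0_norm (ltW a0)) /= mul1r.
  rewrite ler_piMr ?exprn_ge0 ?(ltW a0)//.
  by rewrite ler_norml cos_geN1 cos_le1.
have cG := @is_cvg_geometric_series R 1 a na1.
set G := limn (series (geometric 1 a)) in cG.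
have cu t : cvgn (series (u t)).
  apply: (@normed_cvg R R^o); apply: (series_le_cvg _ _ (u_le t) cG) => n //.
  exact: geometric_ge0 (ltW a0).
have tail t N : `|w t - series (u t) N| <= G - series (geometric 1 a) N.
  have h1 : `|series (u t) n - series (u t) N| @[n --> \oo] -->
      `|w t - series (u t) N|.
    by apply: cvg_norm; apply: (@cvgB _ R^o); [exact: cu|exact: cvg_cst].
  have h2 : series (geometric 1 a) n - series (geometric 1 a) N @[n --> \oo] -->
      G - series (geometric 1 a) N.
    by apply: (@cvgB _ R^o); [exact: cG|exact: cvg_cst].
  apply: (ler_cvg_to h1 h2); near=> n.
  have Nn : (N <= n)%N by near: n; exact: nbhs_infty_ge.
  rewrite !sub_series Nn (le_trans (ler_norm_sum _ _ _))//.
  by rewrite ler_sum// => i _; exact: u_le.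
have cS N : continuous (fun t => series (u t) N).
  elim: N => [|N IH] t.
    by under eq_fun do rewrite /series/= big_geq//; exact: cvg_cst.
  have -> : (fun s => series (u s) N.+1) =
      (fun s => series (u s) N) + (u ^~ N).
    by apply/funext => s; rewrite seriesSr.
  apply: (@continuousD R R^o R _ _ t) (IH t) _.
  apply: (@continuousZl_tmp R R^o R
    (fun s => cos ((b ^+ N)%:~R * pi * s)) (a ^+ N)).
  apply: (@continuous_comp _ _ _ (fun s : R => (b ^+ N)%:~R * pi * s) (@cos R)).
    exact: mulrl_continuous.
  exact: continuous_cos.
have cw : continuous w.
  move=> t; apply/cvgrPdist_lt => e e0.
  have e30 : 0 < e / 3 by rewrite divr_gt0.
  have /cvgrPdist_lt/(_ _ e30)[N _ /(_ N (leqnn N)) GN] := cG.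
  have /cvgrPdist_lt/(_ _ e30) := cS N t.
  apply: filterS => s ts.
  have := tail t N; have := tail s N; move: ts (le_lt_trans (ler_norm _) GN).
  have -> : w t - w s = (w t - series (u t) N) +
      (series (u t) N - series (u s) N) - (w s - series (u s) N) by ring.
  move=> ts GN' ws wt.
  rewrite (le_lt_trans (ler_normB _ _))//.
  rewrite (le_lt_trans (lerD (ler_normD _ _) (lexx _)))//.
  lra.
move=> p; apply: (@continuous_comp _ _ _
  (fun p : 'I[R] * 'I[R] => \val p.1 - \val p.2 : R) w); last exact: cw.
have vc : continuous (\val : 'I[R] -> R) by exact: initial_continuous.
apply: (@cvgB _ R^o).
  apply: (@continuous_comp _ _ _ fst (\val : 'I[R] -> R)).
    exact: cvg_fst.
  exact: vc.
apply: (@continuous_comp _ _ _ snd (\val : 'I[R] -> R)).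
  exact: cvg_snd.
exact: vc.
Unshelve. all: by end_near. Qed.
Arguments weierstrass_continuous {R a} b.

Section Embedding.
Context {R : realType} {K : 'I[R] -> 'I[R] -> R}.
Context (cK : continuous (fun p : 'I[R] * 'I[R] => K p.1 p.2)) (H : rkhs K).

Definition rkhs_embed (f : H) : CI R :=
  MkCI (asboolT (@rkhs_continuous R 'I[R] K H cK f)).

Lemma rkhs_embed_linear : linear rkhs_embed.
Proof. by move=> c f g; apply/val_inj; rewrite /= linearP. Qed.

HB.instance Definition _ :=
  GRing.isLinear.Build R H (CI R) _ rkhs_embed rkhs_embed_linear.

End Embedding.
Arguments rkhs_embed {R K} cK H f.

(* Main.v *)
(* Sampling kernel sections on the grid of b^(n+2) equispaced points, discrete
   orthogonality and aliasing show that finite combinations of kernel sections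
   reproduce the waves a^n cos(b^n pi y - th) exactly. With th in {0, pi/2} they
   are orthogonal in H of norm q^n, where q = sqrt a, and pairing f with such a
   wave in H is a quadrature, hence bounded by twice the sup norm of f.

   Upper bound: the part of W(x, .) beyond the first M frequencies has squared
   norm a^M / (1 - a), so truncating at M costs q^M / sqrt(1 - a) uniformly on
   the unit ball, and the 2M remaining coefficients are rounded to K + 1 values.
   Lower bound: combinations of the first M waves with coefficients on a grid of
   step 5 eps are more than 2 eps apart in sup norm, which gives (P + 1)^M
   separated elements of the unit ball. Taking M of order ln(1/eps) / ln(1/a)
   with K and P powers of 1/eps makes both logarithms of order
   ln(1/eps)^2 / ln(1/a). *)
Require Import Defs.
From mathcomp Require Import all_boot all_order all_algebra.
From mathcomp Require Import all_classical all_reals all_analysis.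
From mathcomp Require Import ring lra.

Import Order.TTheory GRing.Theory Num.Theory.
Import numFieldNormedType.Exports.

Local Open Scope classical_set_scope.
Local Open Scope ring_scope.

(** * Discrete orthogonality of cosines on a grid *)

(* Multiplying by [2 sin (pi k / N)] makes the sum telescope. *)
Lemma sum_cos_grid (R : realType) (N k : nat) (phi : R) : (0 < k < N)%N ->
  \sum_(j < N) cos ((j * k)%:R / N%:R * (pi *+ 2) + phi) = 0.
Proof.
move=> /andP[k0 kN]; have N0 : N%:R != 0 :> R by rewrite pnatr_eq0; case: N kN.
pose h : R := k%:R / N%:R * pi.
have sh : sin h != 0.
  rewrite gt_eqF// sin_gt0_pi// /h; apply/andP; split.
    by rewrite mulr_gt0 ?pi_gt0// divr_gt0 ?ltr0n// (leq_trans _ kN).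
  rewrite gtr_pMl ?pi_gt0// ltr_pdivrMr ?ltr0n ?(leq_trans _ kN)//.
  by rewrite mul1r ltr_nat.
have step M : sin h *+ 2 *
      \sum_(j < M) cos ((j * k)%:R / N%:R * (pi *+ 2) + phi) =
    sin ((M * k)%:R / N%:R * (pi *+ 2) + (phi - h)) - sin (phi - h).
  elim: M => [|M IH]; first by rewrite big_ord0 mulr0 mul0n !mul0r add0r subrr.
  rewrite big_ord_recr/= mulrDr IH.
  set t := (M * k)%:R / N%:R * (pi *+ 2) + phi.
  have -> : (M * k)%:R / N%:R * (pi *+ 2) + (phi - h) = t - h.
    by rewrite /t; ring.
  have -> : (M.+1 * k)%:R / N%:R * (pi *+ 2) + (phi - h) = t + h.
    by rewrite /t /h !natrM -natr1; ring.
  by rewrite (sinD t h) (sinB t h); ring.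
(* The last angle exceeds the first by [k] full turns, so the telescoped difference vanishes. *)
have := step N; have -> : (N * k)%:R / N%:R * (pi *+ 2) + (phi - h) =
    phi - h + pi *+ 2 *+ k.
  by rewrite mulnC natrM mulfK// mulr_natl addrC.
rewrite (periodicn (@sinD2pi R)) subrr => /eqP.
by rewrite mulf_eq0 mulrn_eq0 /= (negPf sh) => /eqP.
Qed.

(* With [2 b^n < b^(n+2)] the grid resolves frequency [b^n], while frequencies
   [b^m] with [m >= n + 2] are aliased to constants. *)
Lemma cos_grid_orthogonal (R : realType) (b n m : nat) (phi psi : R) :
  (1 < b)%N ->
  2 / (b ^ n.+2)%:R * \sum_(j < b ^ n.+2)
      cos ((j * b ^ n)%:R / (b ^ n.+2)%:R * (pi *+ 2) + phi) *
      cos ((j * b ^ m)%:R / (b ^ n.+2)%:R * (pi *+ 2) + psi) =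
  if m == n then cos (phi - psi) else 0.
Proof.
move=> b1; set N := (b ^ n.+2)%N; have b0 : (0 < b)%N by exact: ltnW.
have N0 : N%:R != 0 :> R by rewrite pnatr_eq0 -lt0n expn_gt0 b0.
have bn0 k : (0 < b ^ k)%N by rewrite expn_gt0 b0.
have [mn|mn] := ltnP m n.+2; last first.
  rewrite gtn_eqF; last exact: leq_trans mn.
  under eq_bigr => j _.
    have -> : cos ((j * b ^ m)%:R / N%:R * (pi *+ 2) + psi) = cos psi.
      rewrite -(subnK mn) expnD -/N mulnA natrM mulfK// mulr_natl addrC.
      exact: (periodicn (@cosD2pi R)).
    over.
  rewrite -mulr_suml sum_cos_grid ?mul0r ?mulr0//.
  by rewrite bn0 ltn_exp2l// ltnS leqnSn.
(* As [b >= 2], [b^n + b^(n+1) < b^(n+2)]: sum and difference of the frequencies stay below [N], so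
   only a zero difference survives. *)
have sumlt : (0 < b ^ n + b ^ m < N)%N.
  rewrite addn_gt0 bn0/=; case: b => [//|[//|b]] in b1 b0 N N0 bn0 *.
  rewrite (@leq_ltn_trans (b.+2 ^ n + b.+2 ^ n.+1))//.
    by rewrite leq_add2l leq_exp2l.
  rewrite /N !expnS mulnA -mulSn ltn_pmul2r//.
  rewrite (@leq_trans (b.+2 * 2))// ?leq_mul2l//.
  by rewrite muln2 -addnn !addnS !addSn !ltnS leq_addl.
have prodE j : cos ((j * b ^ n)%:R / N%:R * (pi *+ 2) + phi) *
      cos ((j * b ^ m)%:R / N%:R * (pi *+ 2) + psi) =
    2^-1 * cos ((j * (b ^ n + b ^ m))%:R / N%:R * (pi *+ 2) + (phi + psi)) +
    2^-1 * cos ((j * b ^ n)%:R / N%:R * (pi *+ 2) + phi -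
      ((j * b ^ m)%:R / N%:R * (pi *+ 2) + psi)).
  have -> : (j * (b ^ n + b ^ m))%:R / N%:R * (pi *+ 2) + (phi + psi) =
    ((j * b ^ n)%:R / N%:R * (pi *+ 2) + phi) +
      ((j * b ^ m)%:R / N%:R * (pi *+ 2) + psi) by rewrite mulnDr natrD; ring.
  by rewrite cosB (cosD (_ + phi)); field.
under eq_bigr => j _ do rewrite prodE.
rewrite big_split/= -!mulr_sumr sum_cos_grid// mulr0 add0r.
have sub k l (al be : R) : (k < l < N)%N ->
    \sum_(j < N) cos ((j * l)%:R / N%:R * (pi *+ 2) + al -
       ((j * k)%:R / N%:R * (pi *+ 2) + be)) = 0.
  move=> /andP[kl lN]; under eq_bigr => j _.
    have -> : (j * l)%:R / N%:R * (pi *+ 2) + al -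
       ((j * k)%:R / N%:R * (pi *+ 2) + be) =
       (j * (l - k))%:R / N%:R * (pi *+ 2) + (al - be).
      by rewrite mulnBr natrB ?leq_mul2l ?(ltnW kl) ?orbT//; ring.
    over.
  by apply: sum_cos_grid; rewrite subn_gt0 kl/= (leq_ltn_trans (leq_subr _ _)).
move: sumlt => /andP[_ sumlt].
have bnN : (b ^ n < N)%N := leq_ltn_trans (leq_addr _ _) sumlt.
have bmN : (b ^ m < N)%N := leq_ltn_trans (leq_addl _ _) sumlt.
case: ltngtP => [lt|gt|->].
- by rewrite sub ?mulr0// bnN ltn_exp2l ?lt.
- under eq_bigr => j _ do rewrite -cosN opprB.
  by rewrite sub ?mulr0// bmN ltn_exp2l ?gt.
- under eq_bigr => j _ do rewrite opprD addrACA subrr add0r.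
  by rewrite sumr_const card_ord -[_ *+ N]mulr_natr; field.
Qed.

(** * Linearity of the inner product *)

Section RkhsDot.
Context {R : realType} {X : Type} {K : X -> X -> R} (H : rkhs K).
Local Notation "''[' u , v ]" := (rkhs_dot H u v).

Lemma rkhs_dotZr (c : R) (f g : H) : '[f, c *: g] = c * '[f, g].
Proof. exact: linearZr_LR. Qed.

Lemma rkhs_dot_sumr (I : Type) (r : seq I) (P : pred I) (f : H) (F : I -> H) :
  '[f, \sum_(i <- r | P i) F i] = \sum_(i <- r | P i) '[f, F i].
Proof. exact: linear_sumr. Qed.

End RkhsDot.

(** * Covers, separated families and rounding *)

Lemma covered_by_finite (R : realType) (X Y : completeNormedModType R) (eps : R)
    (T : {linear X -> Y}) (J : finType) (y : J -> Y) : 0 < eps ->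
  (forall x, `|x| <= 1 -> exists j, `|T x - y j| <= eps) ->
  Defs.covered_by eps T #|J|.
Proof.
move=> eps0 cov; exists (fun i => y (enum_val i)) => _ [x x1 <-].
have [j xj] := cov x x1; exists (enum_rank j) => //.
exists (eps^-1 *: (T x - y j)); rewrite /unit_ball/=.
  by rewrite normrZ gtr0_norm ?invr_gt0// ler_pdivrMl// mulr1.
by rewrite enum_rankK scalerA divff ?gt_eqF// scale1r addrC subrK.
Qed.

(** Pigeonhole: two points in one ball of radius [eps] are at most [2 eps] apart, so choosing a
    centre for each [j] is injective. *)
Lemma covered_by_separated (R : realType) (X Y : completeNormedModType R)
    (eps : R) (T : {linear X -> Y}) (J : finType) (x : J -> X) (n : nat) :
  0 < eps -> (forall j, `|x j| <= 1) ->
  (forall i j, `|T (x i) - T (x j)| <= eps *+ 2 -> i = j) ->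
  Defs.covered_by eps T n -> (#|J| <= n)%N.
Proof.
move=> eps0 x1 sep [y cov].
have /choice[c cP] j : exists i, `|T (x j) - y i| <= eps.
  have [|i _ [u u1 <-]] := cov (T (x j)).
    by exists (x j) => //; exact: x1.
  exists i; rewrite addrC addKr normrZ gtr0_norm// -[leRHS]mulr1.
  by rewrite ler_pM2l.
rewrite -[n]card_ord; apply: (@leq_card _ _ c) => i j cij; apply: sep.
rewrite -(subrKA (y (c i))) (le_trans (ler_normD _ _))// mulr2n lerD//.
by rewrite distrC cij.
Qed.

(** One finite cover excludes the default 0: the set of cover sizes is nonempty, hence has the least
    element that [xget] returns. *)
Lemma covering_numberP (R : realType) (X Y : completeNormedModType R) (eps : R)
    (T : {linear X -> Y}) (n : nat) : Defs.covered_by eps T n ->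
  Defs.covered_by eps T (covering_number eps T) /\
  (covering_number eps T <= n)%N.
Proof.
move=> covn.
have ex : exists k, `[< Defs.covered_by eps T k >] by exists n; apply/asboolP.
rewrite /covering_number; set A := (X in xget _ X).
suff /(xgetPex 0%N)[cov min] : exists k, A k by split; [|exact: min].
case: (ex_minnP ex) => k /asboolP covk kmin; exists k; split => // m covm.
by apply: kmin; apply/asboolP.
Qed.

Lemma quantize (R : realType) (K : nat) (t : R) : (0 < K)%N -> `|t| <= 1 ->
  exists p : 'I_K.+1, `|t - (p%:R / K%:R *+ 2 - 1)| <= 2 / K%:R.
Proof.
move=> K0; have K0R : (0 : R) < K%:R by rewrite ltr0n.
rewrite ler_norml => /andP[t1 t2].
(* Rounding [z] down costs at most one grid step; [t = 1] gives [p = K], whence [K + 1] values. *)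
pose z := (t + 1) * K%:R / 2.
have z0 : 0 <= z by rewrite /z divr_ge0// mulr_ge0 ?ler0n//; lra.
have /andP[z1 z2] := truncn_itv z0.
have zK : z <= K%:R by rewrite /z ler_pdivrMr// mulrC ler_pM2l//; lra.
have pK : (Num.trunc z < K.+1)%N by rewrite ltnS -(ler_nat R) (le_trans z1).
exists (Ordinal pK) => /=; set p := (Num.trunc z)%:R in z1 z2 *.
have -> : t - (p / K%:R *+ 2 - 1) = 2 / K%:R * (z - p).
  by rewrite /z; field; rewrite gt_eqF.
rewrite normrM ger0_norm ?divr_ge0// ler_piMr ?divr_ge0//.
rewrite ger0_norm ?subr_ge0// lerBlDr addrC natr1 ?ltW//.
Qed.

(** * Waves, quadrature nodes and modes *)

Section WeierstrassRkhs.
Context {R : realType} {a : R} {b : nat}.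
Hypotheses (ha : 0 < a < 1) (b1 : (1 < b)%N).
Context (H : rkhs (weierstrass a (b : int))).
Local Notation "''[' u , v ]" := (rkhs_dot H u v).
Local Notation W := (weierstrass a (b : int)).
Implicit Types (f g : H) (x y : 'I[R]) (n m : nat) (th psi : R).

Let a0 : 0 < a. Proof. by case/andP: ha. Qed.
Let a1 : a < 1. Proof. by case/andP: ha. Qed.

Definition wave n th x : R := cos ((b ^ n)%:R * pi * \val x - th).

Lemma wave_le1 n th x : `|wave n th x| <= 1.
Proof. exact: cos_max. Qed.

(** [limn] by itself asserts no convergence; a geometric majorant supplies it. *)
Lemma weierstrass_cvg x y :
  series (fun n => a ^+ n * wave n ((b ^ n)%:R * pi * \val y) x) @ \oo -->
  W x y.
Proof.
have -> : (fun n => a ^+ n * wave n ((b ^ n)%:R * pi * \val y) x) =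
    (fun n => a ^+ n * cos (((b : int) ^+ n)%:~R * pi * (\val x - \val y))).
  apply/funext => n; rewrite /wave -mulrBr; congr (_ * cos (_ * _ * _)).
  by rewrite natrX rmorphXn.
apply: (@normed_cvg R R^o).
have na1 : `|a| < 1 by rewrite ger0_norm// ltW.
apply: (series_le_cvg _ _ _ (@is_cvg_geometric_series R 1 a na1)) => n.
- exact: normr_ge0.
- by rewrite geometric_ge0// ltW.
rewrite /= normrM normrX (ger0_norm (ltW a0)) mul1r.
by rewrite ler_piMr ?exprn_ge0 ?(ltW a0)// cos_max.
Qed.

(** The endpoint 1 is left out, so the nodes fill one period. The default [zeroI] is never taken, by
    [val_node]. *)
Definition node n (j : 'I_(b ^ n.+2)) : 'I[R] :=
  insubd zeroI (j%:R / (b ^ n.+2)%:R *+ 2 - 1).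

Lemma val_node n (j : 'I_(b ^ n.+2)) :
  \val (node n j) = j%:R / (b ^ n.+2)%:R *+ 2 - 1.
Proof.
rewrite val_insubd ifT//; apply/mem_set; rewrite /itv11/= in_itv/=.
have N0 : (0 : R) < (b ^ n.+2)%:R by rewrite ltr0n expn_gt0 ltnW.
have j0 : 0 <= j%:R / (b ^ n.+2)%:R :> R by rewrite divr_ge0.
have j1 : j%:R / (b ^ n.+2)%:R <= 1 :> R.
  by rewrite ler_pdivrMr// mul1r ler_nat ltnW.
lra.
Qed.

Lemma wave_orthogonal n m th psi :
  2 / (b ^ n.+2)%:R * \sum_j wave n th (node n j) * wave m psi (node n j) =
  if m == n then cos (th - psi) else 0.
Proof.
have waveE k al j : wave k al (node n j) =
    cos ((j * b ^ k)%:R / (b ^ n.+2)%:R * (pi *+ 2) +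
      (- ((b ^ k)%:R * pi) - al)).
  rewrite /wave val_node natrM; congr (cos _); ring.
under eq_bigr do rewrite !waveE.
rewrite cos_grid_orthogonal//; case: eqP => // ->.
by rewrite -cosN; congr (cos _); ring.
Qed.

Definition kernel_section x : H := s2val (cid2 (rkhs_kernel H x)).

Lemma kernel_sectionE x : rkhs_fun H (kernel_section x) = W x.
Proof. by rewrite /kernel_section; case: cid2. Qed.

Lemma reproducing f x : rkhs_fun H f x = '[f, kernel_section x].
Proof. by rewrite /kernel_section; case: cid2. Qed.

(* The factor [2 / N] makes the quadrature over [N] nodes extract from the
   Weierstrass series exactly the term of frequency [b^n]: see [modeE]. *)
Definition mode n th : H :=
  (2 / (b ^ n.+2)%:R) *:
    \sum_j wave n th (node n j) *: kernel_section (node n j).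

Lemma dot_mode f n th : '[f, mode n th] =
  2 / (b ^ n.+2)%:R * \sum_j wave n th (node n j) * rkhs_fun H f (node n j).
Proof.
rewrite rkhs_dotZr rkhs_dot_sumr; congr (_ * _); apply: eq_bigr => j _.
by rewrite rkhs_dotZr -reproducing.
Qed.

(** The quadrature keeps only the term [m = n] of a partial sum, so the approximations are constant
    from index [n + 1] on. *)
Lemma modeE n th y : rkhs_fun H (mode n th) y = a ^+ n * wave n th y.
Proof.
rewrite reproducing rkhs_dotC dot_mode kernel_sectionE.
pose u N := 2 / (b ^ n.+2)%:R * \sum_j wave n th (node n j) *
  series (fun m => a ^+ m * wave m ((b ^ m)%:R * pi * \val (node n j)) y) N.
have cu : u @ \oo --> 2 / (b ^ n.+2)%:R *
    \sum_j wave n th (node n j) * W y (node n j).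
  apply: cvgMl_tmp => //; apply: (@cvg_big R^o) => [|j _].
    exact: add_continuous.
  by apply: cvgMl_tmp => //; exact: weierstrass_cvg.
have uE N : (n < N)%N -> u N = a ^+ n * wave n th y.
  move=> nN; rewrite /u.
  under eq_bigr => j _.
    rewrite /series/= mulr_sumr.
    under eq_bigr => m _.
      (* Cosine is even, so [y] and the node exchange roles. *)
      have -> : wave m ((b ^ m)%:R * pi * \val (node n j)) y =
          wave m ((b ^ m)%:R * pi * \val y) (node n j).
        by rewrite /wave -cosN opprB.
      rewrite mulrCA.
      over.
    over.
  rewrite exchange_big/= mulr_sumr.
  under eq_bigr do rewrite -mulr_sumr mulrCA wave_orthogonal.
  rewrite (bigD1_seq n)/= ?mem_index_iota ?iota_uniq// eqxx big1 ?addr0.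
    by rewrite /wave -cosN opprB.
  by move=> m /negPf ->; rewrite mulr0.
have uEnear : \forall N \near \oo, u N = a ^+ n * wave n th y.
  by exists n.+1 => // N /= /uE.
exact: (cvg_unique _ cu (cvg_near_cst _ uEnear)).
Qed.

Local Notation T := (rkhs_embed (weierstrass_continuous (b : int) ha) H).
Local Notation q := (Num.sqrt a).

Let sqrtX n : Num.sqrt (a ^+ n) = q ^+ n.
Proof.
by rewrite -{1}(sqr_sqrtr (ltW a0)) exprAC sqrtr_sqr ger0_norm.
Qed.

Let exprE n : a ^+ n = q ^+ n * q ^+ n.
Proof. by rewrite -expr2 exprAC sqr_sqrtr// ltW. Qed.

Lemma dot_modes n m th psi :
  '[mode m psi, mode n th] = if m == n then a ^+ n * cos (th - psi) else 0.
Proof.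
rewrite dot_mode; under eq_bigr do rewrite modeE mulrCA.
rewrite -mulr_sumr mulrCA wave_orthogonal.
by case: eqP => [->|]; rewrite ?mulr0.
Qed.

Lemma norm_mode n th : `|mode n th| = q ^+ n.
Proof.
by rewrite rkhs_normE dot_modes eqxx subrr cos0 mulr1 sqrtX.
Qed.

Lemma dot_le_norm f g : `|'[f, g]| <= `|f| * `|g|.
Proof.
rewrite !rkhs_normE -sqrtrM ?rkhs_dot_ge0// -sqrtr_sqr.
by rewrite ler_sqrt ?rkhs_CauchySchwarz// mulr_ge0 ?rkhs_dot_ge0.
Qed.

(** The bound is uniform in [n]: closeness in supremum norm controls all coefficients alike, as the
    lower bound requires. *)
Lemma dot_mode_le f n th : `|'[f, mode n th]| <= 2 * `|T f|.
Proof.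
have N0 : (0 : R) < (b ^ n.+2)%:R by rewrite ltr0n expn_gt0 ltnW.
rewrite dot_mode normrM ger0_norm ?divr_ge0// -mulrA ler_pM2l//.
rewrite mulrC ler_pdivrMr// (le_trans (ler_norm_sum _ _ _))//.
rewrite mulr_natr -[X in _ *+ X]card_ord -sumr_const ler_sum// => j _.
rewrite normrM -[leRHS]mul1r ler_pM// ?wave_le1//.
exact: (CI_norm_ge (T f)).
Qed.

(** * Truncated expansion of kernel sections *)

Definition phase (s : bool) : R := if s then pi / 2 else 0.

Lemma wave_sqr n x : \sum_(s : bool) wave n (phase s) x ^+ 2 = 1.
Proof.
by rewrite big_bool/= /wave subr0 cosBpihalf addrC cos2Dsin2.
Qed.

Lemma dot_modes_phase n m s t : '[mode m (phase s), mode n (phase t)] =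
  if (m == n) && (s == t) then a ^+ n else 0.
Proof.
rewrite dot_modes; case: eqP => //= _.
by case: s t => -[]/=;
  rewrite ?subrr ?sub0r ?subr0 ?cosN ?cos0 ?cos_pihalf ?mulr1 ?mulr0.
Qed.

Lemma weierstrass_diag x : W x x = (1 - a)^-1.
Proof.
have na1 : `|a| < 1 by rewrite ger0_norm// ltW.
have := weierstrass_cvg x x.
have -> : (fun n => a ^+ n * wave n ((b ^ n)%:R * pi * \val x) x) =
    geometric 1 a.
  by apply/funext => n; rewrite /wave subrr cos0 mulr1 /= mul1r.
move=> cW; rewrite (cvg_unique _ cW (cvg_geometric_series na1)) ?mul1r//.
Qed.

(** The subtracted sum is the orthogonal projection on the first [2 M] modes: the pairing
    [a^n * wave] divided by the squared norm [a^n]. *)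
Definition residual M x : H := kernel_section x -
  \sum_(n < M) \sum_s wave n (phase s) x *: mode n (phase s).

Lemma dot_residual M f x : '[f, residual M x] = rkhs_fun H f x -
  \sum_(n < M) \sum_s '[f, mode n (phase s)] * wave n (phase s) x.
Proof.
rewrite linearBr /= -reproducing rkhs_dot_sumr; congr (_ - _).
apply: eq_bigr => n _; rewrite rkhs_dot_sumr; apply: eq_bigr => s _.
by rewrite rkhs_dotZr mulrC.
Qed.

(* The residual is orthogonal to the truncated part, so its squared norm is its
   own value at [x], that is the tail [\sum_(n >= M) a ^+ n]. *)
Lemma dnorm_residual M x : '[residual M x, residual M x] = a ^+ M / (1 - a).
Proof.
have dot0 (n : 'I_M) s : '[residual M x, mode n (phase s)] = 0.
  rewrite rkhs_dotC dot_residual modeE (bigD1 n)//= (bigD1 s)//=.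
  rewrite dot_modes_phase !eqxx/=.
  rewrite !big1 => [|m mn|t ts]; first by rewrite !addr0 subrr.
    rewrite big1// => t _.
    by rewrite dot_modes_phase val_eqE eq_sym (negPf mn) mul0r.
  by rewrite dot_modes_phase eq_sym (negPf ts) andbF mul0r.
rewrite dot_residual big1 => [|n _]; last first.
  by rewrite big1// => s _; rewrite dot0 mul0r.
rewrite subr0 reproducing rkhs_dotC dot_residual kernel_sectionE.
rewrite weierstrass_diag.
(* By [wave_sqr], the two phases of frequency [n] together remove [a^n] from [W x x]. *)
under eq_bigr => n _.
  under eq_bigr do rewrite rkhs_dotC -reproducing modeE -mulrA -expr2.
  rewrite -mulr_sumr wave_sqr mulr1.
  over.
have -> : \sum_(n < M) a ^+ n = series (geometric 1 a) M.
  by rewrite /series/= big_mkord; apply: eq_bigr => n _; rewrite mul1r.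
rewrite geometric_seriesE ?lt_eqF//= mul1r; field.
by rewrite subr_eq0 gt_eqF.
Qed.

Lemma truncation_error M f x : `|f| <= 1 ->
  `|rkhs_fun H f x -
    \sum_(n < M) \sum_s '[f, mode n (phase s)] * wave n (phase s) x| <=
  q ^+ M / Num.sqrt (1 - a).
Proof.
move=> f1; rewrite -dot_residual (le_trans (dot_le_norm _ _))//.
apply: le_trans (ler_piMl (normr_ge0 _) f1) _.
rewrite [leLHS]rkhs_normE dnorm_residual sqrtrM ?exprn_ge0 ?(ltW a0)//.
by rewrite sqrtrV ?subr_ge0 ?(ltW a1)// sqrtX.
Qed.

(** * Covering bounds for fixed parameters *)

Lemma rkhs_fun_sum (I : Type) (r : seq I) (P : pred I) (F : I -> H) x :
  rkhs_fun H (\sum_(i <- r | P i) F i) x =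
  \sum_(i <- r | P i) rkhs_fun H (F i) x.
Proof.
rewrite reproducing rkhs_dotC rkhs_dot_sumr; apply: eq_bigr => i _.
by rewrite rkhs_dotC -reproducing.
Qed.

Lemma rkhs_funZ (c : R) f x : rkhs_fun H (c *: f) x = c * rkhs_fun H f x.
Proof. by rewrite linearZ. Qed.

(** On the unit ball a coefficient at frequency [n] is at most [q^n]; rounding it relative to [q^n]
    costs [2 / K * q^n] for each of the two phases. *)
Lemma weierstrass_covered (M K : nat) (eps : R) : (0 < K)%N -> 0 < eps ->
  q ^+ M / Num.sqrt (1 - a) + \sum_(n < M) (2 / K%:R * q ^+ n) *+ 2 <= eps ->
  Defs.covered_by eps T (K.+1 ^ (M * 2))%N.
Proof.
move=> K0 eps0 le_eps.
have q0 : 0 < q by rewrite sqrtr_gt0.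
pose grid (p : 'I_K.+1) : R := p%:R / K%:R *+ 2 - 1.
(* A mode has values [q^n * q^n * wave], so dividing by [q^n] leaves the coefficient
   [grid * q^n]. *)
pose h (p : {ffun 'I_M * bool -> 'I_K.+1}) : H :=
  \sum_(n < M) \sum_s (grid (p (n, s)) / q ^+ n) *: mode n (phase s).
have -> : (K.+1 ^ (M * 2))%N = #|{ffun 'I_M * bool -> 'I_K.+1}|.
  by rewrite card_ffun card_prod !card_ord card_bool.
apply: (@covered_by_finite _ _ _ _ _ _ (T \o h)) => // f f1.
have /fin_all_exists[p pP] (i : 'I_M * bool) : exists p : 'I_K.+1,
    `|'[f, mode i.1 (phase i.2)] / q ^+ i.1 - grid p| <= 2 / K%:R.
  apply: quantize => //; rewrite normrM normfV.
  rewrite (ger0_norm (exprn_ge0 _ (ltW q0))) ler_pdivrMr ?exprn_gt0// mul1r.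
  have qi0 : 0 <= q ^+ i.1 by rewrite exprn_ge0// ltW.
  by rewrite (le_trans (dot_le_norm _ _))// norm_mode ler_piMl.
exists (finfun p); apply: CI_norm_le => x.
change (`|rkhs_fun H f x - rkhs_fun H (h (finfun p)) x| <= eps).
pose S := \sum_(n < M) \sum_s '[f, mode n (phase s)] * wave n (phase s) x.
rewrite -(subrKA S) (le_trans (ler_normD _ _))// (le_trans _ le_eps)//.
rewrite lerD ?truncation_error// /h rkhs_fun_sum /S -sumrB.
rewrite (le_trans (ler_norm_sum _ _ _))// ler_sum// => n _.
have -> : (2 / K%:R * q ^+ n) *+ 2 = \sum_(s : bool) 2 / K%:R * q ^+ n.
  by rewrite big_bool mulr2n.
rewrite rkhs_fun_sum -sumrB (le_trans (ler_norm_sum _ _ _))// ler_sum// => s _.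
rewrite rkhs_funZ modeE mulrA -mulrBl normrM -[leRHS]mulr1.
rewrite ler_pM// ?wave_le1// ffunE.
have -> : '[f, mode n (phase s)] - grid (p (n, s)) / q ^+ n * a ^+ n =
    ('[f, mode n (phase s)] / q ^+ n - grid (p (n, s))) * q ^+ n.
  by rewrite exprE; field; rewrite expf_neq0 ?gt_eqF.
rewrite normrM (ger0_norm (exprn_ge0 _ (ltW q0))) ler_pM2r ?exprn_gt0//.
exact: (pP (n, s)).
Qed.

(** Phase 0 suffices. Term [i] of a combination has norm at most [5 eps P / q^i], so the smallness
    hypothesis keeps combinations in the unit ball. *)
Lemma weierstrass_covering_ge (M P n : nat) (eps : R) : 0 < eps ->
  5 * eps * P%:R * \sum_(i < M) (q ^+ i)^-1 <= 1 ->
  Defs.covered_by eps T n -> (P.+1 ^ M <= n)%N.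
Proof.
move=> eps0 small.
have q0 : 0 < q by rewrite sqrtr_gt0.
pose h (p : {ffun 'I_M -> 'I_P.+1}) : H :=
  \sum_(i < M) (5 * eps * (p i)%:R / a ^+ i) *: mode i 0.
have -> : (P.+1 ^ M)%N = #|{ffun 'I_M -> 'I_P.+1}|.
  by rewrite card_ffun !card_ord.
apply: (@covered_by_separated _ _ _ _ _ _ h) => // [p|p p' pp'].
  rewrite (le_trans _ small)// mulr_sumr (le_trans (ler_norm_sum _ _ _))//.
  rewrite ler_sum// => i _; rewrite normrZ norm_mode.
  have -> : 5 * eps * (p i)%:R / a ^+ i = 5 * eps * (p i)%:R / q ^+ i / q ^+ i.
    by rewrite exprE invfM mulrA.
  rewrite normrM normfV (ger0_norm (exprn_ge0 _ (ltW q0))).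
  rewrite divfK ?expf_neq0 ?gt_eqF// normrM normfV.
  rewrite (ger0_norm (exprn_ge0 _ (ltW q0))) ler_pM2r ?invr_gt0 ?exprn_gt0//.
  rewrite ger0_norm ?mulr_ge0 ?(ltW eps0)//.
  by rewrite ler_pM2l ?mulr_gt0// ler_nat -ltnS.
apply/ffunP => i; apply/val_inj/eqP => /=.
have hE (r : {ffun 'I_M -> 'I_P.+1}) : '[h r, mode i 0] = 5 * eps * (r i)%:R.
  rewrite rkhs_dotC rkhs_dot_sumr (bigD1 i)//= big1 => [|j ji].
    rewrite rkhs_dotZr dot_modes eqxx subrr cos0 mulr1 addr0.
    by rewrite divfK// expf_neq0// gt_eqF.
  by rewrite rkhs_dotZr dot_modes val_eqE eq_sym (negPf ji) mulr0.
(* Images within [2 eps] have coefficients within [4 eps], less than the step [5 eps]. *)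
have : `|'[h p - h p', mode i 0]| <= 4 * eps.
  rewrite (le_trans (dot_mode_le _ _ _))//.
  by rewrite linearB (le_trans (ler_wpM2l _ pp'))//; lra.
have -> : '[h p - h p', mode i 0] = 5 * eps * ((p i)%:R - (p' i)%:R).
  by rewrite rkhs_dotC linearBr /= !(rkhs_dotC (mode _ _)) !hE mulrBr.
rewrite normrM ger0_norm ?mulr_ge0 ?(ltW eps0)// => le4.
have lt1 : `|(p i)%:R - (p' i)%:R| < 1 :> R.
  have e5 : 0 < 5 * eps by lra.
  by rewrite -(ltr_pM2l e5); lra.
move: lt1; rewrite ltr_norml => /andP[l1 l2].
rewrite eqn_leq -ltnS -[(p' i <= _)%N]ltnS -!(ltr_nat R) -!natr1.
by apply/andP; split; lra.
Qed.

End WeierstrassRkhs.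

(** * Two-sided bounds and geometric sums *)

Lemma asymp_at_0_bounded (R : realType) (f g : R -> R) (c1 c2 : R) : 0 < c1 ->
  (\forall e \near 0^'+, c1 <= f e / g e <= c2) -> asymp_at_0 f g.
Proof.
move=> c10 bd; rewrite /asymp_at_0; set u := fun e => _; split.
- rewrite /limf_einf oppe_gt0; apply: (@le_lt_trans _ _ (- c1)%:E); last first.
    by rewrite lte_fin oppr_lt0.
  apply: ge_ereal_inf; eexists; first by eexists; first exact: bd.
  apply: ge_ereal_sup => _ [e /andP[ce _] <-].
  by rewrite /u -EFinN lee_fin lerN2.
(* Any two sets of the filter share a point [e], where both sides are compared with [u e]. *)
- rewrite /limf_einf; apply: le_ereal_inf_tmp => _ [V FV <-].
  rewrite leeNl; apply: le_ereal_inf_tmp => _ [V' FV' <-].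
  have [e [Ve V'e]] := @filter_ex _ _ _ _ (filterI FV FV').
  apply: (@le_trans _ _ (- u e)%E).
    by rewrite leeN2; apply: le_ereal_sup_tmp; exists (u e) => //; exists e.
  by apply: le_ereal_sup_tmp; exists (- u e)%E => //; exists e.
- apply: (@le_lt_trans _ _ c2%:E); last exact: ltry.
  apply: ge_ereal_inf; eexists; first by eexists; first exact: bd.
  by apply: ge_ereal_sup => _ [e /andP[_ ec] <-]; rewrite lee_fin.
Qed.

Lemma sum_exprV_le {R : realFieldType} {q : R} (M : nat) : 0 < q < 1 ->
  \sum_(i < M) (q ^+ i)^-1 <= (q ^+ M)^-1 / (1 - q).
Proof.
move=> /andP[q0 q1]; have q10 : 0 < 1 - q by rewrite subr_gt0.
rewrite ler_pdivlMr//; elim: M => [|M IH].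
  by rewrite big_ord0 mul0r invr_ge0 ler01.
have qM : 0 < (q ^+ M)^-1 by rewrite invr_gt0 exprn_gt0.
rewrite big_ord_recr/= mulrDl exprS invfM; set z := (q ^+ M)^-1 in IH qM *.
(* This is the slack left in the induction step once [IH] bounds the previous sum. *)
have : 0 <= z * (q^-1 * (1 - q) ^+ 2).
  by rewrite mulr_ge0 ?(ltW qM)// mulr_ge0 ?sqr_ge0// invr_ge0 ltW.
have -> : z * (q^-1 * (1 - q) ^+ 2) = q^-1 * z - z - z * (1 - q).
  by field; rewrite gt_eqF.
lra.
Qed.

Lemma sum_expr_le {R : realFieldType} {q : R} (M : nat) : 0 < q < 1 ->
  \sum_(i < M) q ^+ i <= (1 - q)^-1.
Proof.
move=> /andP[q0 q1]; have q10 : 0 < 1 - q by rewrite subr_gt0.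
rewrite -[leRHS]mul1r ler_pdivlMr// mulrC -[1 - q]opprB mulNr -subrX1 opprB.
by rewrite gerBl exprn_ge0// ltW.
Qed.

(** * Choice of parameters, later with [q = sqrt a] and [s = sqrt (1 - a)] *)

Section CoveringParams.
Context {R : realType} (q s : R).
Hypotheses (hq : 0 < q < 1) (s0 : 0 < s).
Local Notation L eps := (ln (1 / (eps * s))).

Let q0 : 0 < q. Proof. by case/andP: hq. Qed.
Let q1 : 0 < 1 - q. Proof. by case/andP: hq => _; rewrite subr_gt0. Qed.
Let r := - ln q.
Let r0 : 0 < r. Proof. by rewrite oppr_gt0 ln_lt0. Qed.

Let exprE M : q ^+ M = expR (- (M%:R * r)).
Proof. by rewrite -mulrN opprK expRM_natl lnK. Qed.

Let expL eps : 0 < eps -> expR (L eps) = (eps * s)^-1.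
Proof. by move=> eps0; rewrite lnK ?div1r// posrE invr_gt0 mulr_gt0. Qed.

Lemma ln_inv_near (A : R) : \forall eps \near 0^'+, 0 < eps /\ A <= L eps.
Proof.
have d0 : 0 < expR (- A) / s by rewrite divr_gt0 ?expR_gt0.
near=> eps; have eps0 : 0 < eps by near: eps; exact: nbhs_right_gt.
split => //; rewrite -ler_expR expL// -[A]opprK expRN.
rewrite lef_pV2 ?posrE ?expR_gt0 ?mulr_gt0//.
by rewrite -ler_pdivlMr// ltW//; near: eps; exact: nbhs_right_lt.
Unshelve. all: by end_near. Qed.

(** [M] near [(L + ln 2) / r] brings the truncation error below [eps / 2], and [K] near
    [8 / (eps (1 - q))] does so for rounding. *)
Lemma cover_parameters : exists c : R, forall eps, 0 < eps -> 1 <= L eps ->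
  exists M K : nat, [/\ (0 < K)%N,
    q ^+ M / s + \sum_(n < M) (2 / K%:R * q ^+ n) *+ 2 <= eps &
    ln (K.+1 ^ (M * 2))%:R <= c * L eps ^+ 2].
Proof.
(* Chosen for [M <= A L] and [K + 1 <= B e^L]; the assumption [1 <= L] absorbs additive
   constants. *)
pose B := 8 * s / (1 - q) + 2; pose A := (1 + ln 2) / r + 1.
have B1 : 1 <= B.
  have : 0 <= 8 * s / (1 - q) by rewrite divr_ge0 ?mulr_ge0 ?ltW.
  rewrite /B; lra.
have B0 : 0 < B := lt_le_trans ltr01 B1.
have ln2 : 0 <= ln 2 :> R by rewrite ln_ge0// ler1n.
exists (2 * A * (1 + ln B)) => eps eps0 L1; set l := L eps in L1 *.
have l0 : 0 <= l by lra.
have el : expR l = (eps * s)^-1 by rewrite /l expL.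
pose x := (l + ln 2) / r; pose y := 8 / (eps * (1 - q)).
have x0 : 0 <= x by rewrite divr_ge0 ?(ltW r0)// addr_ge0.
have y0 : 0 < y by rewrite divr_gt0// mulr_gt0.
have nat_above (z : R) : 0 <= z -> exists n : nat, z < n.+1%:R <= z + 1.
  move=> /truncn_itv/andP[z1 z2]; exists (Num.trunc z).
  by rewrite z2 -natr1 lerD2r.
have [M' /andP[xM Mx]] := nat_above _ x0.
have [K' /andP[y2 Ky]] := nat_above _ (ltW y0).
exists M'.+1, K'.+1; move: M'.+1 K'.+1 (ltn0Sn K') => M K K0 in xM Mx y2 Ky *.
split=> //.
  have KR : 0 < K%:R :> R by rewrite ltr0n.
  have qM : q ^+ M / s <= eps / 2.
    rewrite ler_pdivrMr// exprE.
    have -> : eps / 2 * s = expR (- (l + ln 2)).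
      rewrite expRN expRD el lnK ?posrE//; field.
      by rewrite gt_eqF// gt_eqF.
    by rewrite ler_expR lerN2 -ler_pdivrMr// ltW.
  have sumle : \sum_(n < M) (2 / K%:R * q ^+ n) *+ 2 <= eps / 2.
    under eq_bigr do rewrite -mulr_natl mulrA.
    rewrite -mulr_sumr.
    have K4 : 0 <= 2 * (2 / K%:R) :> R by rewrite mulr_ge0// divr_ge0// ltW.
    rewrite (le_trans (ler_wpM2l K4 (sum_expr_le M hq)))//.
    move/ltW: y2; rewrite /y ler_pdivrMr ?mulr_gt0// => y2.
    have -> : 2 * (2 / K%:R) * (1 - q)^-1 = 4 / (K%:R * (1 - q)).
      by field; rewrite (gt_eqF q1) (gt_eqF KR).
    rewrite ler_pdivrMr ?mulr_gt0//.
    have -> : eps / 2 * (K%:R * (1 - q)) = (K%:R * (eps * (1 - q))) / 2 by ring.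
    by rewrite ler_pdivlMr// (le_trans _ y2)// -natrM.
  by rewrite [leRHS]splitr lerD.
have KB : ln K.+1%:R <= (1 + ln B) * l.
  have KE : K.+1%:R <= B * expR l.
    have e1 : 1 <= expR l by rewrite -expR0 ler_expR.
    have -> : B * expR l = y + 2 * expR l.
      by rewrite /B /y el; field; rewrite (gt_eqF s0) (gt_eqF eps0) (gt_eqF q1).
    by rewrite -natr1; lra.
  apply: (@le_trans _ _ (ln (B * expR l))).
    by rewrite ler_ln ?posrE ?mulr_gt0 ?expR_gt0 ?ltr0n.
  rewrite lnM ?posrE ?expR_gt0// expRK.
  have : 0 <= ln B * (l - 1) by rewrite mulr_ge0 ?subr_ge0// ln_ge0.
  lra.
have MA : M%:R <= A * l.
  have : 0 <= ln 2 / r * (l - 1) by rewrite mulr_ge0 ?subr_ge0// divr_ge0// ltW.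
  move=> ln2l; apply: le_trans Mx _; rewrite /A /x !mulrDl; lra.
rewrite natrX lnXn ?ltr0n// -[ln _ *+ _]mulr_natl natrM.
have -> : 2 * A * (1 + ln B) * l ^+ 2 = A * l * 2 * ((1 + ln B) * l) by ring.
by rewrite ler_pM// ?mulr_ge0 ?ln_ge0 ?ler1n// ler_wpM2r.
Qed.

(** The budget [e^L = 1 / (eps s)] is split evenly: [q^(-M)] and [P] are each of order at most
    [e^(L/2)]. *)
Lemma packing_parameters : exists c A : R, 0 < c /\ forall eps, 0 < eps ->
  A <= L eps -> exists M P : nat,
    5 * eps * P%:R * \sum_(i < M) (q ^+ i)^-1 <= 1 /\
    c * L eps ^+ 2 <= ln (P.+1 ^ M)%:R.
Proof.
(* [E] turns the constraint into an equality when [P] becomes [y] and the sum becomes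
   [e / (1 - q)]. *)
pose E := (1 - q) * s / 5.
have E0 : 0 < E by rewrite divr_gt0// mulr_gt0.
(* [- 4 ln E <= L] gives [ln (P + 1) >= L / 4], and [4 r <= L] gives [M >= L / (4 r)] despite
   rounding down. *)
exists (16 * r)^-1, (Num.max 0 (Num.max (- 4 * ln E) (4 * r))).
split=> [|eps eps0]; first by rewrite invr_gt0 mulr_gt0.
rewrite !ge_max => /and3P[l0 lE lr]; set l := L eps in l0 lE lr *.
have el : expR l = (eps * s)^-1 by rewrite /l expL.
pose x := l / (2 * r); pose y := E * expR (l / 2).
have x0 : 0 <= x by rewrite divr_ge0// mulr_ge0// ltW.
have y0 : 0 < y by rewrite mulr_gt0// expR_gt0.
move: (truncn_itv x0) (truncn_itv (ltW y0)).
move: (Num.trunc x) (Num.trunc y) => M P /andP[x1 x2] /andP[y1 y2]; exists M, P.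
have ell : expR l = expR (l / 2) * expR (l / 2) by rewrite -expRD -splitr.
have e0 := expR_gt0 (l / 2); set e := expR (l / 2) in ell e0 y y0 y1 y2 *.
split.
  have qM : (q ^+ M)^-1 <= e.
    rewrite exprE expRN invrK ler_expR.
    by move: x1; rewrite /x ler_pdivlMr ?mulr_gt0//; lra.
  have Sle : \sum_(i < M) (q ^+ i)^-1 <= e / (1 - q).
    by rewrite (le_trans (sum_exprV_le M hq))// ler_pM2r ?invr_gt0.
  have oneE : 1 = 5 * eps * y * (e / (1 - q)).
    have -> : 5 * eps * y * (e / (1 - q)) = eps * s * (e * e).
      by rewrite /y /E; field; rewrite gt_eqF.
    by rewrite -ell el mulfV// gt_eqF// mulr_gt0.
  rewrite [leRHS]oneE; apply: ler_pM => //.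
  - by rewrite !mulr_ge0 ?(ltW eps0).
  - by rewrite sumr_ge0// => i _; rewrite invr_ge0 exprn_ge0// ltW.
  - by rewrite ler_pM2l// mulr_gt0.
have lnP : l / 4 <= ln P.+1%:R.
  apply: (@le_trans _ _ (ln y)); last first.
    by rewrite ler_ln ?posrE ?ltr0n// ltW.
  by rewrite /y lnM ?posrE// expRK; lra.
have Mle : l / (4 * r) <= M%:R.
  move: x2; rewrite -natr1 /x ltr_pdivrMr ?mulr_gt0// => x2.
  by rewrite ler_pdivrMr ?mulr_gt0//; lra.
rewrite natrX lnXn ?ltr0n// -[ln _ *+ _]mulr_natl.
have -> : (16 * r)^-1 * l ^+ 2 = l / (4 * r) * (l / 4) by field; rewrite gt_eqF.
by rewrite ler_pM// ?divr_ge0// mulr_ge0// ltW.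
Qed.

End CoveringParams.

(** * Combination of the two bounds *)

Theorem theorem1p1 (R : realType) (a : R) (b : int)
    (ha : 0 < a < 1) (hab : 1 <= a * b%:~R) (H : rkhs (weierstrass a b)) :
  asymp_at_0
    (fun eps : R => ln (covering_number eps
       (rkhs_embed (weierstrass_continuous b ha) H))%:R)
    (fun eps : R => ln (1 / (eps * Num.sqrt (1 - a))) ^+ 2 / ln (1 / a)).
Proof.
have /andP[a0 a1] := ha.
(* [a < 1 <= a b] forces [b > 1], so [b] is a natural number. *)
have b1 : (1 : int) < b.
  rewrite -(ltr_int R) -(ltr_pM2l a0) mulr1; exact: lt_le_trans a1 hab.
case: b b1 hab H => [b|//] b1 _ H.
have q01 : 0 < Num.sqrt a < 1.
  by rewrite sqrtr_gt0 a0 -[ltRHS]sqrtr1 ltr_sqrt.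
have s0 : 0 < Num.sqrt (1 - a) by rewrite sqrtr_gt0 subr_gt0.
have [c2 upper] := cover_parameters _ _ q01 s0.
have [c1 [A [c10 lower]]] := packing_parameters _ _ q01 s0.
have k0 : 0 < ln (1 / a) by rewrite div1r lnV// oppr_gt0 ln_lt0.
apply: (@asymp_at_0_bounded _ _ _ (c1 * ln (1 / a)) (c2 * ln (1 / a))).
  by rewrite mulr_gt0.
near=> eps.
have [eps0 L1] : 0 < eps /\ 1 <= ln (1 / (eps * Num.sqrt (1 - a))).
  by near: eps; exact: ln_inv_near.
have [_ LA] : 0 < eps /\ A <= ln (1 / (eps * Num.sqrt (1 - a))).
  by near: eps; exact: ln_inv_near.
have [M [K [K0 /(weierstrass_covered ha b1 H _ _ _ K0 eps0) covK lnK]]] :=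
  upper eps eps0 L1.
have [N [P [/(weierstrass_covering_ge ha b1 H _ _ _ _ eps0) packP lnP]]] :=
  lower eps eps0 LA.
(* The packing bound applies to the optimal cover, whose existence follows from [covK]. *)
have [/packP leP leK] := covering_numberP _ _ _ _ _ _ covK.
set C := covering_number _ _ in leP leK *.
have C0 : (0 < C)%N by rewrite (leq_trans _ leP)// expn_gt0.
set L := ln (1 / (eps * _)) in L1 LA lnK lnP *.
have L0 : 0 < L ^+ 2 by rewrite exprn_gt0// (lt_le_trans ltr01).
have -> : ln C%:R / (L ^+ 2 / ln (1 / a)) = ln C%:R / L ^+ 2 * ln (1 / a).
  by rewrite invf_div mulrCA mulrC.
rewrite !ler_pM2r// ler_pdivlMr// ler_pdivrMr//.
apply/andP; split; [apply: le_trans lnP _|apply: le_trans _ lnK];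
  by rewrite ler_ln ?posrE ?ltr0n ?expn_gt0// ler_nat.
Unshelve. all: by end_near. Qed.
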